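(* Let $K$ be a complete discretely valued field with ring of integers $\mathcal{O}_K$ and uniformiser $\pi$, and let $\rho\colon G\to\mathrm{GL}(V)$ be an irreducible representation of a group $G$ on a finite-dimensional $K$-vector space $V$ admitting at least one $\rho(G)$-stable lattice. Then the tropical convex hull of $\mathcal{X}_{\max}(\rho)$ is $\mathcal{X}(\rho)$. (More precisely, every $\rho(G)$-stable lattice is the intersection of finitely many maximal stable lattices.)
   Context: A lattice is a free $\mathcal{O}_K$-submodule of $V$ of rank $\dim_KV$, $\rho(G)$-stable if $\rho(g)\Lambda=\Lambda$ for all $g$. $\mathcal{X}(V)$ is the set of homothety classes of lattices (classes under $\Lambda\sim\lambda\Lambda$, $\lambda\in K^\times$) and $\mathcal{X}(\rho)$ the set of classes of stable lattices. A set $S$ of classes is tropically convex if for any two lattices $\Lambda_1,\Lambda_2$ representing classes in $S$, the class of $\Lambda_1\cap\Lambda_2$ lies in $S$; the tropical convex hull of a set $S\subseteq\mathcal{X}(V)$ is the intersection of all tropically convex subsets of $\mathcal{X}(V)$ containing $S$. A stable lattice $\Lambda$ is normalised at a nonzero $v\in V$ if $v\in\Lambda$ and its image in $\Lambda/\pi\Lambda$ is nonzero; it is maximal with respect to $v$ if maximal under inclusion among stable lattices normalised at $v$; maximal if maximal with respect to some nonzero $v$. $\mathcal{X}_{\max}(\rho)$ is the set of classes of maximal stable lattices. *)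

(* Defs.v *)
From HB Require Import structures.
From mathcomp Require Import all_boot all_order all_algebra.
From mathcomp Require Import boolp classical_sets.

Set Implicit Arguments.
Unset Strict Implicit.
Unset Printing Implicit Defensive.

Import Order.TTheory GRing.Theory Num.Theory.
Local Open Scope classical_set_scope.
Local Open Scope ring_scope.

(* A normalised discrete valuation is a surjective homomorphism K^* -> Z
   satisfying the ultrametric inequality. [dval v 0] is a meaningless integer:
   the value +oo at 0 is encoded by the disjunct [x = 0] in [dval_ge]. *)
Record discrete_valuation (K : fieldType) := DiscreteValuation {
  dval :> K -> int;
  dvalM : forall x y : K, x != 0 -> y != 0 -> dval (x * y) = dval x + dval y;
  dvalD : forall x y : K, x != 0 -> y != 0 -> x + y != 0 ->
    Num.min (dval x) (dval y) <= dval (x + y);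
  dval_surj : forall n : int, exists2 x : K, x != 0 & dval x = n }.

Definition dval_ge (K : fieldType) (v : discrete_valuation K) (N : int) : set K :=
  [set x | x = 0 \/ N <= v x].

Definition integers (K : fieldType) (v : discrete_valuation K) : set K :=
  dval_ge v 0.

Definition uniformiser (K : fieldType) (v : discrete_valuation K) (pi : K) : Prop :=
  pi != 0 /\ v pi = 1.

Definition dval_cauchy (K : fieldType) (v : discrete_valuation K)
    (u : nat -> K) : Prop :=
  forall N : int, exists n0 : nat, forall m n : nat,
    (n0 <= m)%N -> (n0 <= n)%N -> dval_ge v N (u m - u n).

Definition dval_cvg_to (K : fieldType) (v : discrete_valuation K)
    (u : nat -> K) (l : K) : Prop :=
  forall N : int, exists n0 : nat, forall n : nat,
    (n0 <= n)%N -> dval_ge v N (u n - l).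

Definition dval_complete (K : fieldType) (v : discrete_valuation K) : Prop :=
  forall u : nat -> K, dval_cauchy v u -> exists l : K, dval_cvg_to v u l.

Section Lattices.
Variables (K : fieldType) (v : discrete_valuation K) (V : vectType K).

Definition int_free (n : nat) (b : 'I_n -> V) : Prop :=
  forall c : 'I_n -> K, (forall i, integers v (c i)) ->
    \sum_(i < n) c i *: b i = 0 -> forall i, c i = 0.

Definition int_span (n : nat) (b : 'I_n -> V) : set V :=
  [set x | exists2 c : 'I_n -> K,
     (forall i, integers v (c i)) & x = \sum_(i < n) c i *: b i].

Definition is_lattice (L : set V) : Prop :=
  exists b : 'I_(\dim {:V}) -> V, int_free b /\ L = int_span b.

Definition homothety (a : K) (L : set V) : set V := [set a *: x | x in L].

Definition homothety_class (L : set V) : set (set V) :=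
  [set L' | exists2 a : K, a != 0 & L' = homothety a L].

Definition lattice_classes : set (set (set V)) :=
  [set homothety_class L | L in is_lattice].

Definition tropically_convex (S : set (set (set V))) : Prop :=
  S `<=` lattice_classes /\
  forall L1 L2 : set V, is_lattice L1 -> is_lattice L2 ->
    S (homothety_class L1) -> S (homothety_class L2) ->
    S (homothety_class (L1 `&` L2)).

Definition tropical_hull (S : set (set (set V))) : set (set (set V)) :=
  \bigcap_(T in [set T | tropically_convex T /\ S `<=` T]) T.

End Lattices.

Section Representations.
Variables (K : fieldType) (V : vectType K) (G : groupType).

(* The two identities force every [rho g] to be invertible, so this is a group
   homomorphism G -> GL(V). *)
Definition is_representation (rho : G -> 'End(V)) : Prop :=
  rho 1%g = \1%VF /\ forall g h : G, rho (g * h)%g = (rho g \o rho h)%VF.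

Definition irreducible_representation (rho : G -> 'End(V)) : Prop :=
  {:V}%VS != 0%VS /\
  forall U : {vspace V}, (forall g, (rho g @: U <= U)%VS) ->
    U = 0%VS \/ U = {:V}%VS.

Variables (v : discrete_valuation K) (pi : K) (rho : G -> 'End(V)).

Definition stable_lattice (L : set V) : Prop :=
  is_lattice v L /\ forall g : G, [set rho g x | x in L] = L.

Definition stable_classes : set (set (set V)) :=
  [set homothety_class L | L in stable_lattice].

(* [~ homothety pi L x] says that the image of x in L / pi L is nonzero. *)
Definition normalised_at (x : V) (L : set V) : Prop :=
  L x /\ ~ homothety pi L x.

Definition maximal_at (x : V) (L : set V) : Prop :=
  [/\ stable_lattice L, normalised_at x L &
      forall L' : set V, stable_lattice L' -> normalised_at x L' ->
        L `<=` L' -> L' = L].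

Definition maximal_stable_lattice (L : set V) : Prop :=
  exists2 x : V, x != 0 & maximal_at x L.

Definition maximal_classes : set (set (set V)) :=
  [set homothety_class L | L in maximal_stable_lattice].

End Representations.

(* Main.v *)
Require Import Defs.
From HB Require Import structures.
From mathcomp Require Import all_boot all_order all_algebra.
From mathcomp Require Import boolp classical_sets.

Set Implicit Arguments.
Unset Strict Implicit.
Unset Printing Implicit Defensive.

Import Order.TTheory GRing.Theory Num.Theory.
Local Open Scope classical_set_scope.
Local Open Scope ring_scope.

(** Over a complete [K], a separated O_K-submodule of a finite-dimensional space
    is free: a family that is independent modulo [pi] is linearly independent
    over [K], so a longest one exists, and it generates by successive
    approximation. For a stable O_K-submodule [U] of an irreducible [V], the
    intersection of all [pi ^+ n *: U] and the union of all [pi ^- n *: U] are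
    subrepresentations; hence every stable [U] other than 0 and [V] is a lattice.
    Zorn's lemma then puts any stable [L] normalised at [x] inside some [M x]
    maximal at [x]. If [x 0, ..., x (m - 1)] in [L] are nonzero modulo [pi] and
    [x j] lies in [pi *: M (x i)] for [i < j], the [x i] are linearly
    independent, because [x i] is not in [pi *: M (x i)]. For a longest such
    family the intersection of the [M (x i)] is [L]: any further element of it
    would have a multiple prolonging the family. *)

(** * Arithmetic of the valuation and of the uniformiser *)

Section Valuation.
Variables (K : fieldType) (v : discrete_valuation K).

Lemma dval1 : v 1 = 0.
Proof.
have /eqP := dvalM v (oner_neq0 K) (oner_neq0 K).
by rewrite mulr1 -subr_eq0 opprD addNKr oppr_eq0 => /eqP.
Qed.

Lemma dvalV (x : K) : x != 0 -> v x^-1 = - v x.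
Proof.
move=> x0; have xV0 : x^-1 != 0 by rewrite invr_eq0.
by apply/eqP; rewrite -addr_eq0 -dvalM // mulVf // dval1.
Qed.

Lemma dvalN1 : v (-1) = 0.
Proof.
have N10 : -1 != 0 :> K by rewrite oppr_eq0 oner_neq0.
have /eqP := dvalM v N10 N10.
by rewrite mulrNN mulr1 dval1 eq_sym -mulr2n mulrn_eq0 /= => /eqP.
Qed.

Lemma dvalX (x : K) n : x != 0 -> v (x ^+ n) = v x *+ n.
Proof.
move=> x0; elim: n => [|n IHn]; first by rewrite expr0 mulr0n dval1.
by rewrite exprS dvalM ?expf_neq0 // IHn mulrS.
Qed.

Lemma dval_ge0 N : dval_ge v N 0.
Proof. by left. Qed.

Lemma dval_geP N (x : K) : x != 0 -> dval_ge v N x -> N <= v x.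
Proof. by move=> x0 []// /eqP; rewrite (negPf x0). Qed.

Lemma dval_geM N M (x y : K) :
  dval_ge v N x -> dval_ge v M y -> dval_ge v (N + M) (x * y).
Proof.
have [->|x0] := eqVneq x 0; first by rewrite mul0r; left.
have [->|y0] := eqVneq y 0; first by rewrite mulr0; left.
move=> /(dval_geP x0) Nx /(dval_geP y0) My; right.
by rewrite dvalM // lerD.
Qed.

Lemma dval_geD N (x y : K) :
  dval_ge v N x -> dval_ge v N y -> dval_ge v N (x + y).
Proof.
have [->|x0] := eqVneq x 0; first by rewrite add0r.
have [->|y0] := eqVneq y 0; first by rewrite addr0.
have [->|xy0] := eqVneq (x + y) 0; first by left.
move=> /(dval_geP x0) Nx /(dval_geP y0) Ny; right.
by apply: le_trans (dvalD v x0 y0 xy0); rewrite le_min Nx.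
Qed.

Lemma dval_ge_le N M (x : K) : M <= N -> dval_ge v N x -> dval_ge v M x.
Proof. by move=> MN [->|Nx]; [left|right; apply: le_trans MN Nx]. Qed.

Lemma integers1 : integers v 1.
Proof. by right; rewrite dval1. Qed.

Lemma integersN1 : integers v (-1).
Proof. by right; rewrite dvalN1. Qed.

Lemma integersM (x y : K) : integers v x -> integers v y -> integers v (x * y).
Proof. by move=> Ox Oy; have := dval_geM Ox Oy; rewrite addr0. Qed.

Lemma dval_geN N (x : K) : dval_ge v N x -> dval_ge v N (- x).
Proof. by move=> Nx; rewrite -mulN1r -[N]add0r; exact: dval_geM integersN1 Nx. Qed.

Lemma dval_geB N (x y : K) :
  dval_ge v N x -> dval_ge v N y -> dval_ge v N (x - y).
Proof. by move=> Nx Ny; apply: dval_geD => //; apply: dval_geN. Qed.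

Lemma integers_unitV (x : K) :
  integers v x -> ~ dval_ge v 1 x -> x != 0 /\ integers v x^-1.
Proof.
have [->|x0] := eqVneq x 0; first by move=> _ []; left.
move=> /(dval_geP x0) x_ge0 x_lt1; split=> //; right.
rewrite dvalV // oppr_ge0 leNgt; apply/negP => vx; apply: x_lt1; right.
by rewrite -gtz0_ge1.
Qed.

Variable pi : K.
Hypothesis pi_unif : uniformiser v pi.

Lemma unif_neq0 : pi != 0. Proof. by case: pi_unif. Qed.

Lemma dval_ge_unifX n : dval_ge v n%:Z (pi ^+ n).
Proof.
by right; rewrite dvalX ?unif_neq0 //; case: pi_unif => _ ->; rewrite natz.
Qed.

(** This turns bounds on the valuation into divisibility by powers of [pi], the form in which
    modules see them. *)
Lemma dval_ge_unif_div n (x : K) : dval_ge v n%:Z x <-> integers v (pi ^- n * x).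
Proof.
split=> [nx|Ox]; last first.
  have := dval_geM (dval_ge_unifX n) Ox.
  by rewrite addr0 mulVKf // expf_neq0 ?unif_neq0.
have pin0 : pi ^+ n != 0 by rewrite expf_neq0 ?unif_neq0.
rewrite /integers -(addNr n%:Z); apply: dval_geM nx; right.
by rewrite dvalV // dvalX ?unif_neq0 //; case: pi_unif => _ ->; rewrite natz.
Qed.

Lemma unifX_integers n : integers v (pi ^+ n).
Proof. by apply: dval_ge_le (dval_ge_unifX n). Qed.

Lemma unif_integers : integers v pi.
Proof. exact: (unifX_integers 1). Qed.

Lemma unif_mul_integers (a : K) : exists n, integers v (pi ^+ n * a).
Proof.
have [->|a0] := eqVneq a 0; first by exists 0%N; rewrite mulr0; left.
exists `|v a|%N; right.
rewrite dvalM ?expf_neq0 ?unif_neq0 // dvalX ?unif_neq0 //.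
case: pi_unif => _ ->; rewrite natz abszE.
by rewrite -lerBlDr sub0r -normrN ler_norm.
Qed.

Lemma unif_nonunit : ~ integers v pi^-1.
Proof.
have pi0 := unif_neq0.
move=> /(dval_geP _); rewrite invr_eq0 => /(_ pi0).
by rewrite dvalV //; case: pi_unif => _ ->.
Qed.

End Valuation.

(** * Integral submodules, residual independence and successive approximation *)

Section Modules.
Variables (K : fieldType) (v : discrete_valuation K) (V : vectType K).

Definition int_module (U : set V) : Prop :=
  [/\ U 0, forall x y, U x -> U y -> U (x + y) &
      forall a x, integers v a -> U x -> U (a *: x)].

Lemma int_module_sum (U : set V) m (F : 'I_m -> V) :
  int_module U -> (forall i, U (F i)) -> U (\sum_(i < m) F i).
Proof. by move=> [U0 UD _] UF; apply: big_ind. Qed.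

Lemma int_moduleB (U : set V) (x y : V) :
  int_module U -> U x -> U y -> U (x - y).
Proof.
move=> [_ UD UZ] Ux Uy; apply: UD => //.
by rewrite -scaleN1r; apply: UZ => //; apply: integersN1.
Qed.

Lemma int_moduleI (U1 U2 : set V) :
  int_module U1 -> int_module U2 -> int_module (U1 `&` U2).
Proof.
move=> [U10 U1D U1Z] [U20 U2D U2Z]; split=> [|x y [] ? ? []|a x Oa []] //.
- by split; [exact: U1D|exact: U2D].
- by split; [exact: U1Z|exact: U2Z].
Qed.

Lemma int_module_homothety (a : K) (U : set V) :
  int_module U -> int_module (homothety a U).
Proof.
move=> [U0 UD UZ]; split.
- by exists 0 => //; rewrite scaler0.
- by move=> _ _ [x Ux <-] [y Uy <-]; exists (x + y); rewrite ?scalerDr//; apply: UD.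
- move=> b _ Ob [x Ux <-]; exists (b *: x); first exact: UZ.
  by rewrite !scalerA mulrC.
Qed.

Lemma homothetyE (a : K) (U : set V) (x : V) :
  a != 0 -> homothety a U x <-> U (a^-1 *: x).
Proof.
move=> a0; split=> [[y Uy <-]|Ux]; first by rewrite scalerA mulVf // scale1r.
by exists (a^-1 *: x); rewrite // scalerA divff // scale1r.
Qed.

Lemma int_module_span n (b : 'I_n -> V) : int_module (int_span v b).
Proof.
split.
- exists (fun=> 0) => [i|]; first exact: dval_ge0.
  by rewrite big1 // => i _; rewrite scale0r.
- move=> _ _ [c Oc ->] [d Od ->]; exists (fun i => c i + d i) => [i|].
    by apply: dval_geD; [exact: Oc|exact: Od].
  by rewrite -big_split; apply: eq_bigr => i _; rewrite scalerDl.
- move=> a _ Oa [c Oc ->]; exists (fun i => a * c i) => [i|].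
    by apply: integersM; last exact: Oc.
  by rewrite scaler_sumr; apply: eq_bigr => i _; rewrite scalerA.
Qed.

(** A subspace of largest dimension inside [W] exhausts [W], since adjoining a missing vector would
    raise the dimension. Irreducibility speaks of [{vspace V}], whereas the subrepresentations below
    arise as sets. *)
Lemma linear_set_vspace (W : set V) :
  W 0 -> (forall a x y, W x -> W y -> W (a *: x + y)) ->
  exists U : {vspace V}, forall x, x \in U <-> W x.
Proof.
move=> W0 Wlin.
pose P d := `[< exists2 U : {vspace V}, \dim U = d & {in U, forall x, W x} >].
have exP : exists d, P d.
  by exists 0%N; apply/asboolP; exists 0%VS;
    rewrite ?dimv0 // => x; rewrite memv0 => /eqP ->.
have ubP d : P d -> (d <= \dim {:V})%N.
  by move/asboolP => [U <- _]; apply/dimvS/subvf.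
case: (ex_maxnP exP ubP) => d /asboolP[U dimU UW] maxd.
exists U => x; split=> [|Wx]; first exact: UW.
apply: contrapT => /negP xU.
have /maxd : P (\dim (<[x]> + U)%VS).
  apply/asboolP; exists (<[x]> + U)%VS => // z.
  by move/memv_addP => [_ /vlineP[a ->] [u uU ->]]; apply: Wlin; last exact: UW.
rewrite leqNgt => /negP; apply; rewrite -dimU ltn_neqAle dimvS ?addvSr // andbT.
apply: contra xU => /eqP eq_dim.
have /eqP -> : U == (<[x]> + U)%VS by rewrite eqEdim addvSr eq_dim leqnn.
by rewrite -{1}[x]addr0 memv_add ?memv_line ?mem0v.
Qed.

(** Families are indexed by [nat] and truncated at [m], so that prolonging one by a vector changes
    no type. *)
Definition free_family m (x : nat -> V) : Prop :=
  forall c : nat -> K, \sum_(i < m) c i *: x i = 0 ->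
    forall i, (i < m)%N -> c i = 0.

Lemma free_family_free m (x : nat -> V) :
  free_family m x -> free [tuple x i | i < m].
Proof.
move=> x_free; apply/freeP => k; pose c j := if insub j is Some i then k i else 0.
have cE (i : 'I_m) : c i = k i by rewrite /c valK.
move=> k0 i; rewrite -cE; apply: x_free => //; rewrite -[RHS]k0.
by apply: eq_bigr => j _; rewrite cE -tnth_nth tnth_mktuple.
Qed.

Lemma free_family_dim m (x : nat -> V) : free_family m x -> (m <= \dim {:V})%N.
Proof.
move=> /free_family_free; rewrite /free => /eqP.
by rewrite size_tuple => <-; apply/dimvS/subvf.
Qed.

(* A relation can be rescaled so that its coefficients are integral and one of
   them is a unit. *)
Lemma residual_free_family m (x : nat -> V) :
  (forall c : nat -> K, (forall i, integers v (c i)) ->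
     \sum_(i < m) c i *: x i = 0 -> forall i, (i < m)%N -> dval_ge v 1 (c i)) ->
  free_family m x.
Proof.
move=> res c c0 i im; apply: contrapT => /eqP ci0.
case: (arg_minP (fun j : 'I_m => v (c j)) (i0 := Ordinal im)
  (P := fun j => c j != 0) ci0) => j cj0 minj.
(* The value 0 beyond [m] is needed because [res] asks for integrality at every index. *)
pose d k := if (k < m)%N then (c j)^-1 * c k else 0.
have dE (k : 'I_m) : d k = (c j)^-1 * c k by rewrite /d ltn_ord.
have Od k : integers v (d k).
  rewrite /d; case: ltnP => km; last exact: dval_ge0.
  have [->|ck0] := eqVneq (c k) 0; first by rewrite mulr0; left.
  right; rewrite dvalM ?invr_eq0 // dvalV // addrC subr_ge0.
  exact: (minj (Ordinal km)).
have /(res d Od)/(_ j (ltn_ord j)) : \sum_(k < m) d k *: x k = 0.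
  under eq_bigr do rewrite dE -scalerA.
  by rewrite -scaler_sumr c0 scaler0.
rewrite dE mulVf // => /(dval_geP (oner_neq0 _)).
by rewrite dval1.
Qed.

Variable pi : K.
Hypothesis pi_unif : uniformiser v pi.

Lemma int_module_unifX (U : set V) (x : V) n k :
  int_module U -> (n <= k)%N -> U (pi ^+ n *: x) -> U (pi ^+ k *: x).
Proof.
move=> [_ _ UZ] nk Ux; rewrite -(subnK nk) exprD -scalerA.
by apply: UZ => //; apply: unifX_integers.
Qed.

(* Images in [U / pi U] linearly independent over the residue field. *)
Definition residually_indep (U : set V) m (x : nat -> V) : Prop :=
  (forall i, (i < m)%N -> U (x i)) /\
  forall c : nat -> K, (forall i, integers v (c i)) ->
    U (pi^-1 *: \sum_(i < m) c i *: x i) ->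
    forall i, (i < m)%N -> dval_ge v 1 (c i).

Lemma residually_indep_free (U : set V) m (x : nat -> V) :
  int_module U -> residually_indep U m x -> free_family m x.
Proof.
move=> [U0 _ _] [_ res]; apply: residual_free_family => c Oc c0.
by apply: res => //; rewrite c0 scaler0.
Qed.

(** Residually independent families are free over [K], so their length is bounded and a longest one
    exists. A vector of [U] outside its span modulo [pi] would prolong it. *)
Lemma ex_residual_generators (U : set V) : int_module U ->
  exists m (x : nat -> V), residually_indep U m x /\
    forall y, U y -> exists2 cz : (nat -> K) * V,
      (forall i, integers v (cz.1 i)) /\ U cz.2 &
      y = \sum_(i < m) cz.1 i *: x i + pi *: cz.2.
Proof.
move=> Umod; have [U0 UD UZ] := Umod; have pi0 := unif_neq0 pi_unif.
pose P m := `[< exists x, residually_indep U m x >].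
have exP : exists m, P m.
  by exists 0%N; apply/asboolP; exists (fun=> 0); split.
have ubP m : P m -> (m <= \dim {:V})%N.
  by move/asboolP => [x /(residually_indep_free Umod)/free_family_dim].
case: (ex_maxnP exP ubP) => m /asboolP[x [Ux res]] maxm.
exists m, x; split=> // y Uy; apply: contrapT => no_cz.
pose x' i := if i == m then y else x i.
have x'E (i : 'I_m) : x' i = x i by rewrite /x' ltn_eqF.
have /maxm : P m.+1; last by rewrite ltnn.
apply/asboolP; exists x'; split=> [i|c Oc].
  by rewrite ltnS leq_eqVlt /x'; case: eqP => //= _; apply: Ux.
rewrite big_ord_recr /= {2}/x' eqxx.
under eq_bigr do rewrite x'E.
move=> Uc.
(* If the coefficient of [y] were a unit, the relation could be solved for [y], against [no_cz]. *)
have cm1 : dval_ge v 1 (c m).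
  apply: contrapT => /(integers_unitV (Oc m))[cm0 Ocm].
  apply: no_cz.
  set s := \sum_(i < m) _ in Uc.
  exists (fun i => - (c m)^-1 * c i, (c m)^-1 *: (pi^-1 *: (s + c m *: y))).
    split=> [i|] /=; last exact: UZ.
    by apply: integersM => //; apply: dval_geN.
  rewrite /= (_ : \sum_(i < m) _ = - (c m)^-1 *: s); last first.
    by rewrite scaler_sumr; apply: eq_bigr => i _; rewrite scalerA.
  rewrite !scalerA mulrCA divff // mulr1 scalerDr scalerA mulVf // scale1r.
  by rewrite scaleNr addKr.
move=> i; rewrite ltnS leq_eqVlt => /orP[/eqP -> //|im].
apply: res im => //.
(* As [pi] divides [c m], dropping the term in [y] leaves a relation modulo [pi] among the [x i]
   alone. *)
have -> : pi^-1 *: \sum_(i < m) c i *: x i =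
    pi^-1 *: (\sum_(i < m) c i *: x i + c m *: y) - (pi^-1 * c m) *: y.
  by rewrite -scalerA -scalerBr addrK.
apply: int_moduleB => //; apply: UZ => //.
by have /(dval_ge_unif_div pi_unif 1) := cm1; rewrite expr1.
Qed.

(** Iterating the decomposition modulo [pi] expands a vector of [U] as a series in the generators.
    Completeness sums the coefficients, and separatedness kills the difference, which lies in every
    [pi ^+ n *: U]. *)
Lemma separated_int_module (U : set V) :
  dval_complete v -> int_module U ->
  (forall y, (forall n, U (pi ^- n *: y)) -> y = 0) ->
  exists m (x : nat -> V),
    free_family m x /\ U = int_span v (fun i : 'I_m => x i).
Proof.
move=> Kc Umod Usep; have [U0 UD UZ] := Umod; have pi0 := unif_neq0 pi_unif.
have [m [x [xind gen]]] := ex_residual_generators Umod.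
exists m, x; split; first exact: residually_indep_free xind.
have [Ux _] := xind.
rewrite eqEsubset; split=> [y Uy|_ [c Oc ->]]; last first.
  by apply: int_module_sum => // i; apply: UZ => //; apply: Ux.
have [F FP] : {F : V -> (nat -> K) * V & forall y, U y ->
    ((forall i, integers v ((F y).1 i)) /\ U (F y).2) /\
    y = \sum_(i < m) (F y).1 i *: x i + pi *: (F y).2}.
  apply: (choice (P := fun z (cz : (nat -> K) * V) => U z ->
    ((forall i, integers v (cz.1 i)) /\ U cz.2) /\
    z = \sum_(i < m) cz.1 i *: x i + pi *: cz.2)) => z.
  have [Uz|nUz] := pselect (U z); last by exists (fun=> 0, 0).
  by have [cz ? ?] := gen z Uz; exists cz.
(* [z n] is the remainder after [n] divisions by [pi], and [s n i] below the partial sum of the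
   coefficient of [x i]. *)
pose z n := iter n (fun y => (F y).2) y.
have Uz n : U (z n) by elim: n => //= n /FP[[_ ?] _].
pose s n i := \sum_(k < n) pi ^+ k * (F (z k)).1 i.
have yE n : y = \sum_(i < m) s n i *: x i + pi ^+ n *: z n.
  elim: n => [|n IHn].
    rewrite expr0 scale1r big1 ?add0r // => i _.
    by rewrite /s big_ord0 scale0r.
  rewrite {1}IHn {1}(proj2 (FP _ (Uz n))) scalerDr scalerA -exprSr addrA.
  congr (_ + _); rewrite scaler_sumr -big_split /=; apply: eq_bigr => i _.
  by rewrite scalerA -scalerDl /s big_ord_recr.
have s_near n k i : (n <= k)%N -> dval_ge v n%:Z (s k i - s n i).
  elim: k => [|k IHk]; first by rewrite leqn0 => /eqP ->; rewrite subrr; left.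
  rewrite leq_eqVlt => /orP[/eqP ->|nk]; first by rewrite subrr; left.
  rewrite /s big_ord_recr /= addrAC; apply: dval_geD; first exact: IHk.
  have [[Oc _] _] := FP _ (Uz k).
  rewrite -[n%:Z]addr0; apply: dval_geM; last exact: Oc.
  by apply: dval_ge_le (dval_ge_unifX pi_unif k); rewrite lez_nat.
have [l lP] : {l : nat -> K & forall i, dval_cvg_to v (s^~ i) (l i)}.
  apply: (choice (P := fun j => dval_cvg_to v (s^~ j))) => i; apply: Kc => N.
  exists `|N|%N => p q Np Nq.
  have NN : N <= `|N|%N%:Z by rewrite abszE ler_norm.
  apply: dval_ge_le NN _.
  rewrite -[s p i](subrK (s `|N|%N i)) -addrA; apply: dval_geD; first exact: s_near.
  by rewrite -opprB; apply: dval_geN; apply: s_near.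
have l_near n i : dval_ge v n%:Z (l i - s n i).
  (* The index [maxn k0 n] is late enough to be close both to the limit and to [s n i]. *)
  have [k0 /(_ (maxn k0 n) (leq_maxl _ _)) sl] := lP i n%:Z.
  have := dval_geB (s_near n (maxn k0 n) i (leq_maxr _ _)) sl.
  by rewrite opprB addrC addrA subrK.
exists l => [i|].
  by have := l_near 0%N i; rewrite /s big_ord0 subr0.
apply/eqP; rewrite -subr_eq0; apply/eqP/Usep => n.
have -> : pi ^- n *: (y - \sum_(i < m) l i *: x i) =
    z n - \sum_(i < m) (pi ^- n * (l i - s n i)) *: x i.
  rewrite {1}(yE n) addrAC scalerDr scalerA mulVf ?expf_neq0 // scale1r.
  rewrite [RHS]addrC; congr (_ + _).
  rewrite -sumrB scaler_sumr -sumrN; apply: eq_bigr => i _.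
  by rewrite -scalerBl scalerA -scaleNr -mulrN opprB.
apply: int_moduleB => //; apply: int_module_sum => // i; apply: UZ; last exact: Ux.
by apply: (dval_ge_unif_div pi_unif n _).1; apply: l_near.
Qed.

End Modules.

(** * Stable modules of an irreducible representation *)

Section StableLattices.
Variables (K : fieldType) (v : discrete_valuation K) (pi : K).
Variables (V : vectType K) (G : groupType) (rho : G -> 'End(V)).
Hypotheses (Kcomplete : dval_complete v) (pi_unif : uniformiser v pi).
Hypotheses (rho_rep : is_representation rho).
Hypotheses (rho_irr : irreducible_representation rho).

Let pi0 : pi != 0 := unif_neq0 pi_unif.

Definition stable_module (U : set V) : Prop :=
  int_module v U /\ forall g x, U x -> U (rho g x).

Lemma irreducible_linear_set (W : set V) :
  W 0 -> (forall a x y, W x -> W y -> W (a *: x + y)) ->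
  (forall g x, W x -> W (rho g x)) ->
  (forall x, W x -> x = 0) \/ (forall x, W x).
Proof.
move=> W0 Wlin Wrho; have [U UW] := linear_set_vspace W0 Wlin.
have [_ /(_ U) []] := rho_irr.
- by move=> g; apply/subvP => _ /memv_imgP[x /UW Wx ->]; apply/UW/Wrho.
- by move=> U0; left => x /UW; rewrite U0 memv0 => /eqP.
- by move=> UT; right => x; apply/UW; rewrite UT memvf.
Qed.

(** The vectors with some multiple [pi ^+ n *: y] in [U] form a subrepresentation, nonzero because
    of [y0]. *)
Lemma stable_module_absorbing (U : set V) (y0 : V) :
  stable_module U -> U y0 -> y0 != 0 -> forall y, exists n, U (pi ^+ n *: y).
Proof.
move=> [Umod Urho] Uy0 /eqP y00; have [U0 UD UZ] := Umod.
have [] := @irreducible_linear_set [set y | exists n, U (pi ^+ n *: y)].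
- by exists 0%N; rewrite scaler0.
- move=> a x y [n Ux] [k Uy]; have [j Oa] := unif_mul_integers pi_unif a.
  exists (j + n + k)%N; rewrite scalerDr; apply: UD; last first.
    by apply: (int_module_unifX pi_unif Umod _ Uy); rewrite leq_addl.
  apply: (int_module_unifX pi_unif Umod (leq_addr k (j + n))).
  by rewrite scalerA exprD mulrAC -scalerA; apply: UZ.
- by move=> g x [n Ux]; exists n; rewrite -linearZ; apply: Urho.
- by move=> W0; case: y00; apply: W0; exists 0%N; rewrite expr0 scale1r.
- by [].
Qed.

(** The vectors divisible in [U] by every power of [pi] form a subrepresentation, proper because it
    misses [z]. *)
Lemma stable_module_separated (U : set V) (z : V) :
  stable_module U -> ~ U z ->
  forall y, (forall n, U (pi ^- n *: y)) -> y = 0.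
Proof.
move=> [Umod Urho] nUz; have [U0 UD UZ] := Umod.
have [] := @irreducible_linear_set [set y | forall n, U (pi ^- n *: y)].
- by move=> n; rewrite scaler0.
- move=> a x y Ux Uy n; have [j Oa] := unif_mul_integers pi_unif a.
  rewrite scalerDr; apply: UD => //.
  (* Dividing [x] by [j] further powers of [pi] pays for the denominator of [a]. *)
  have -> : pi ^- n *: (a *: x) = (pi ^+ j * a) *: (pi ^- (j + n) *: x).
    by rewrite !scalerA exprD invfM mulrACA divff ?expf_neq0 // mul1r mulrC.
  exact: UZ.
- by move=> g x Ux n; rewrite -linearZ; apply: Urho.
- by [].
- by move/(_ z 0%N); rewrite expr0 invr1 scale1r.
Qed.

Lemma stable_image (U : set V) (g : G) :
  (forall h x, U x -> U (rho h x)) -> [set rho g x | x in U] = U.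
Proof.
move=> Urho; rewrite eqEsubset; split=> [_ [x Ux <-]|x Ux]; first exact: Urho.
exists (rho g^-1%g x); first exact: Urho.
by have [rho1 rhoM] := rho_rep; rewrite -comp_lfunE -rhoM mulgV rho1 id_lfunE.
Qed.

(** Missing [z] makes [U] separated, hence free with a basis independent over [K]; containing [y]
    makes [U] absorbing, so this basis spans [V] and has [\dim {:V}] elements. *)
Lemma stable_module_lattice (U : set V) (y z : V) :
  stable_module U -> U y -> y != 0 -> ~ U z -> stable_lattice v rho U.
Proof.
move=> Ust Uy y0 nUz; have [Umod Urho] := Ust.
split; last by move=> g; apply: stable_image.
have [m [x [x_free UE]]] := separated_int_module pi_unif Kcomplete Umod
  (stable_module_separated Ust nUz).
suff em : m = \dim {:V}.
  rewrite /is_lattice -em; exists (fun i => x i); split=> // c _ c0.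
  have /freeP/(_ c) := free_family_free x_free; apply.
  by rewrite -[RHS]c0; apply: eq_bigr => i _; rewrite -tnth_nth tnth_mktuple.
apply/eqP; rewrite eqn_leq (free_family_dim x_free) /=.
apply: leq_trans (_ : (\dim <<[tuple x i | i < m]>> <= m)%N); last first.
  by apply: leq_trans (dim_span _) _; rewrite size_tuple.
apply/dimvS/subvP => w _.
have [n] := stable_module_absorbing Ust Uy y0 w.
rewrite UE => -[c _ wE].
rewrite -[w](scalerK (expf_neq0 n pi0)) wE rpredZ //.
rewrite memv_suml // => i _; rewrite rpredZ // memv_span //.
by rewrite -[x i](tnth_mktuple (fun i : 'I_m => x i)) mem_tnth.
Qed.

Lemma stable_latticeP (L : set V) : stable_lattice v rho L ->
  [/\ stable_module L, exists2 y, L y & y != 0 & exists z, ~ L z].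
Proof.
move=> [[b [b_free LE]] Lrho].
have [V0 _] := rho_irr; rewrite -dimv_eq0 -lt0n in V0.
pose i0 := Ordinal V0.
pose e i : K := (i == i0)%:R.
have e_sum : \sum_i e i *: b i = b i0.
  rewrite (bigD1 i0) //= /e eqxx scale1r big1 ?addr0 // => i /negPf ->.
  by rewrite scale0r.
have Oe i : integers v (e i).
  by rewrite /e; case: eqP => _; [exact: integers1|exact: dval_ge0].
split.
- split=> [|g x Lx]; first by rewrite LE; apply: int_module_span.
  by rewrite -(Lrho g); exists x.
- exists (b i0); first by rewrite LE; exists e.
  apply/eqP => bi0; have := b_free e Oe.
  rewrite e_sum => /(_ bi0 i0)/eqP.
  by rewrite /e eqxx oner_eq0.
(* Were this vector in [L], comparing coefficients at [i0] would give [1 = pi * c i0] and make [pi]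
   a unit. *)
- exists (pi^-1 *: b i0); rewrite LE => -[c Oc bE].
  have Od i : integers v (e i - pi * c i).
    apply: dval_geB (Oe i) _; apply: integersM (Oc i).
    exact: unif_integers.
  have /(b_free _ Od)/(_ i0)/eqP : \sum_i (e i - pi * c i) *: b i = 0.
    under eq_bigr do rewrite scalerBl -scalerA.
    by rewrite sumrB e_sum -scaler_sumr -bE scalerA divff // scale1r subrr.
  rewrite /e eqxx subr_eq0 => /eqP e1; apply: (unif_nonunit pi_unif).
  by rewrite -[pi^-1]mulr1 (e1 : 1 = _) mulKf //; apply: Oc.
Qed.

Lemma stable_latticeI (L1 L2 : set V) :
  stable_lattice v rho L1 -> stable_lattice v rho L2 ->
  stable_lattice v rho (L1 `&` L2).
Proof.
move=> /stable_latticeP[st1 [y1 L1y y10] [z1 L1z]].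
move=> /stable_latticeP[st2 [y2 L2y y20] _].
(* Only the existence of a nonzero common vector needs an argument: a multiple of [y1] falls into
   [L2]. *)
have [n Ln] := stable_module_absorbing st2 L2y y20 y1.
apply: (@stable_module_lattice _ (pi ^+ n *: y1) z1).
- split; first by apply: int_moduleI; [case: st1|case: st2].
  by move=> g x [L1x L2x]; split; [apply: st1.2|apply: st2.2].
- split=> //; have [[_ _ L1Z] _] := st1; apply: L1Z L1y.
  exact: unifX_integers.
- by rewrite scaler_eq0 negb_or expf_neq0.
- by case.
Qed.

Lemma stable_lattice_homothety (a : K) (L : set V) :
  a != 0 -> stable_lattice v rho L -> stable_lattice v rho (homothety a L).
Proof.
move=> a0 /stable_latticeP[[Lmod Lrho] [y Ly y0] [z nLz]].
apply: (@stable_module_lattice _ (a *: y) (a *: z)).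
- split=> [|g _ [x Lx <-]]; first exact: int_module_homothety.
  by exists (rho g x); [exact: Lrho|rewrite linearZ].
- by exists y.
- by rewrite scaler_eq0 negb_or a0.
- by move/(homothetyE _ _ a0); rewrite scalerK.
Qed.

(** * Normalised vectors and maximal stable lattices *)

Lemma normalised_atE (x : V) (L : set V) :
  normalised_at pi x L <-> L x /\ ~ L (pi^-1 *: x).
Proof. by have E := homothetyE L x pi0; split=> -[Lx nLx]; split=> // /E. Qed.

(** A nonzero vector of [L] is divided by [pi] as often as [L] allows; separatedness makes this
    stop. *)
Lemma ex_normalised_at (L : set V) :
  stable_lattice v rho L -> exists x, normalised_at pi x L.
Proof.
move=> /stable_latticeP[Lst [y Ly y0] [z nLz]].
have exP : exists n, `[< ~ L (pi ^- n *: y) >].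
  apply: contrapT => all_n; move/eqP: y0; apply.
  apply: (stable_module_separated Lst nLz) => n.
  by apply: contrapT => nLn; apply: all_n; exists n; apply/asboolP.
case: (ex_minnP exP) => -[/asboolP|n /asboolP nLn min_n].
  by rewrite expr0 invr1 scale1r.
exists (pi ^- n *: y); apply/normalised_atE; split.
  by apply: contrapT => /asboolP/min_n; rewrite ltnn.
by rewrite scalerA -invfM -exprS.
Qed.

Lemma ex_maximal_at (L : set V) (x : V) :
  stable_lattice v rho L -> normalised_at pi x L ->
  exists2 M, L `<=` M & maximal_at v pi rho x M.
Proof.
move=> /stable_latticeP[Lst [y Ly y0] _] /normalised_atE[Lx nLx].
pose good U := stable_module U /\ ~ U (pi^-1 *: x).
(* Zorn's lemma also requires the union of the empty chain to qualify. Requiring [good] of [U]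
   joined with [L], instead of [L] inside [U], handles this case because [L] itself is good. *)
have /Zorn_bigcup[A [[gstA gA] maxA]] : forall F : set (set V),
    F `<=` [set U | good (U `|` L)] -> total_on F subset ->
    good ((\bigcup_(X in F) X) `|` L).
  move=> F Fgood Ftot; have [[L0 LD LZ] Lrho] := Lst.
  (* Any two vectors of the union already lie in one good set of the chain, so every closure
     property is inherited. *)
  have mem2 a b : (\bigcup_(X in F) X `|` L) a -> (\bigcup_(X in F) X `|` L) b ->
    exists2 U, good U & [/\ U a, U b & U `<=` \bigcup_(X in F) X `|` L].
    have sub X : F X -> X `|` L `<=` \bigcup_(X in F) X `|` L.
      by move=> FX c [Xc|]; [left; exists X|right].
    have goodL : good L by [].
    case=> [[X FX Xa]|La] [[Y FY Yb]|Lb].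
    - have [XY|YX] := Ftot X Y FX FY.
        exists (Y `|` L); first exact: Fgood.
        by split; [left; apply: XY|left|exact: sub].
      exists (X `|` L); first exact: Fgood.
      by split; [left|left; apply: YX|exact: sub].
    - exists (X `|` L); first exact: Fgood.
      by split; [left|right|exact: sub].
    - exists (Y `|` L); first exact: Fgood.
      by split; [right|left|exact: sub].
    - by exists L => //; split=> // c; right.
  split; first split; first split.
  - by right.
  - move=> a b Ha Hb; have [U [[[_ UD _] _] _] [Ua Ub]] := mem2 a b Ha Hb.
    by apply; apply: UD.
  - move=> a b Oa Hb; have [U [[[_ _ UZ] _] _] [Ub _]] := mem2 b b Hb Hb.
    by apply; apply: UZ.
  - move=> g b Hb; have [U [[_ Urho] _] [Ub _]] := mem2 b b Hb Hb.
    by apply; apply: Urho.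
  - by move=> Hx; have [U [_ nU] [Ux _ _]] := mem2 _ _ Hx Hx; apply: nU.
exists (A `|` L); first by right.
have AL_x : (A `|` L) x by right.
split.
- by apply: (stable_module_lattice gstA _ y0 gA); right.
- exact/normalised_atE.
- move=> B /stable_latticeP[Bst _ _] /normalised_atE[_ nBx] ALB.
  have BL : B `|` L = B by apply: setUidl => c Lc; apply: ALB; right.
  rewrite eqEsubset; split=> // c Bc; left; apply: contrapT => nAc.
  apply: (maxA B); last by rewrite /= BL.
  split; first by move=> d Ad; apply: ALB; left.
  by move=> BA; apply/nAc/BA.
Qed.

(** The exponent is positive because [y] is not in [L]. Hence the multiple divided by [pi] is still
    an integral multiple of [y], and stays in every module containing [y]. *)
Lemma ex_normalised_multiple (L : set V) (y : V) :
  stable_lattice v rho L -> ~ L y ->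
  exists n, normalised_at pi (pi ^+ n.+1 *: y) L.
Proof.
move=> /stable_latticeP[Lst [y0 Ly0 y00] _] nLy.
have exP : exists n, `[< L (pi ^+ n *: y) >].
  have [n Ln] := stable_module_absorbing Lst Ly0 y00 y.
  by exists n; apply/asboolP.
case: (ex_minnP exP) => -[/asboolP|n /asboolP Ln min_n].
  by rewrite expr0 scale1r.
exists n; apply/normalised_atE; split=> //.
rewrite scalerA exprS mulKf // => /asboolP/min_n.
by rewrite ltnn.
Qed.

(** * Stable lattices as finite intersections of maximal ones *)

Lemma stable_lattice_bigcap (L : set V) :
  stable_lattice v rho L ->
  exists (n : nat) (M : 'I_n.+1 -> set V),
    (forall i, maximal_stable_lattice v pi rho (M i)) /\
    L = \bigcap_(i in [set: 'I_n.+1]) M i.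
Proof.
move=> Lst; have [[[L0 _ _] _] _ _] := stable_latticeP Lst.
have [M MP] : {M : V -> set V & forall x, normalised_at pi x L ->
    L `<=` M x /\ maximal_at v pi rho x (M x)}.
  apply: (choice (P := fun x M => normalised_at pi x L ->
    L `<=` M /\ maximal_at v pi rho x M)) => x.
  have [xL|] := pselect (normalised_at pi x L); last by exists set0.
  by have [M LM maxM] := ex_maximal_at Lst xL; exists M.
have Mmod x : normalised_at pi x L -> int_module v (M x).
  by move=> /MP[_ [/stable_latticeP[[]]]].
have Mnorm x : normalised_at pi x L -> M x x /\ ~ M x (pi^-1 *: x).
  by move=> /MP[_ [_ /normalised_atE]].
pose adm m (x : nat -> V) := (forall i, (i < m)%N -> normalised_at pi (x i) L) /\
  forall i j, (i < j < m)%N -> M (x i) (pi^-1 *: x j).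
(* In a relation with a unit coefficient, the smallest index [i] of such a
   coefficient would put [x i] in [pi *: M (x i)]. *)
have adm_free m x : adm m x -> free_family m x.
  move=> [xL xM]; apply: (residual_free_family (v := v)) => c Oc c0 i im.
  apply: contrapT => ci.
  have exP : exists j, (j < m)%N && `[< ~ dval_ge v 1 (c j) >].
    by exists i; rewrite im; apply/asboolP.
  case: (ex_minnP exP) => {ci} {im} {}i /andP[im /asboolP ci] min_i.
  have [ci0 Oci] := integers_unitV (Oc i) ci.
  have [_ MD MZ] := Mmod _ (xL i im); have [_ nM] := Mnorm _ (xL i im).
  have xE : pi^-1 *: x i = (c i)^-1 *: (pi^-1 *: (c i *: x i)).
    by rewrite !scalerA mulrAC mulVf // mul1r.
  apply: nM; rewrite xE; apply: (MZ _ _ Oci).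
  (* The other terms lie in [pi *: M (x i)]: for [j > i] by admissibility, for [j < i] because [pi]
     divides [c j] by minimality of [i] and [x j] is in [L]. *)
  move/eqP: c0; rewrite (bigD1 (Ordinal im)) //= addr_eq0 => /eqP ->.
  rewrite -scaleN1r scalerA mulrC -scalerA; apply: (MZ _ _ (integersN1 v)).
  rewrite scaler_sumr; apply: big_ind => //.
    by case: (Mmod _ (xL i im)).
  move=> j ji.
  have [ij|ji'] := ltnP i j.
    rewrite scalerA mulrC -scalerA; apply: (MZ _ _ (Oc j)).
    by apply: xM; rewrite ij /=.
  have {ji'} ji : (j < i)%N by rewrite ltn_neqAle ji' andbT.
  have cj : dval_ge v 1 (c j).
    apply: contrapT => ncj; have /min_i : (j < m)%N && `[< ~ dval_ge v 1 (c j) >].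
      by rewrite ltn_ord; apply/asboolP.
    by rewrite leqNgt ji.
  rewrite scalerA; apply: MZ.
    by have /(dval_ge_unif_div pi_unif 1) := cj; rewrite expr1.
  by have [LM _] := MP _ (xL i im); apply: LM; case: (xL j (ltn_ord j)).
pose P m := `[< exists x, adm m x >].
(* Starting at length 1 makes the longest family nonempty, as the index type ['I_n.+1] demands. *)
have P1 : P 1%N.
  have [x xL] := ex_normalised_at Lst; apply/asboolP; exists (fun=> x).
  by split=> // i [|j] /andP[].
have ubP m : P m -> (m <= \dim {:V})%N.
  by move/asboolP => [x /adm_free/free_family_dim].
case: (ex_maxnP (ex_intro P _ P1) ubP) => m /asboolP[x [xL xM]] maxm.
case: m => [|n] in xL xM maxm *; first by have := maxm _ P1.
exists n, (fun i : 'I_n.+1 => M (x i)).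
have x0 i : (i < n.+1)%N -> x i != 0.
  move=> /xL/normalised_atE[_ nL]; apply/eqP => xi0.
  by apply: nL; rewrite xi0 scaler0.
split=> [i|]; first by exists (x i); [exact: x0|apply MP; exact: xL].
rewrite eqEsubset; split=> [y Ly i _|y My].
  by have [LM _] := MP _ (xL i (ltn_ord i)); apply: LM.
apply: contrapT => /(ex_normalised_multiple Lst)[k yL].
(* [w] prolongs the family: [y] is in every [M (x i)], hence so is [pi^-1 *: w = pi ^+ k *: y]. *)
pose w := pi ^+ k.+1 *: y.
pose x' i := if i == n.+1 then w else x i.
have /maxm : P n.+2; last by rewrite ltnn.
apply/asboolP; exists x'; split=> [i|i j].
  by rewrite ltnS leq_eqVlt /x'; case: eqP => //= _; apply: xL.
move=> /andP[ij jn].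
have iN : (i < n.+1)%N by apply: leq_trans ij _.
rewrite /x' (ltn_eqF iN); case: eqP => [_|/eqP jn'].
  rewrite /w scalerA exprS mulKf //.
  have [_ _ MZ] := Mmod _ (xL i iN); apply: MZ; first exact: unifX_integers.
  exact: (My (Ordinal iN)).
by apply: xM; rewrite ij /= ltn_neqAle jn' -ltnS.
Qed.

(** * Tropical convexity *)

Lemma homothety_class_refl (L : set V) : homothety_class L L.
Proof.
exists 1; first exact: oner_neq0.
rewrite eqEsubset; split=> [x Lx|_ [x Lx <-]]; last by rewrite scale1r.
by exists x; rewrite ?scale1r.
Qed.

Lemma stable_classes_convex : tropically_convex v (stable_classes v rho).
Proof.
split=> [_ [L [Llat _] <-]|L1 L2 _ _]; first by exists L.
(* Homotheties preserve stability, so it can be read off any representative of the class. *)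
have stab L : stable_classes v rho (homothety_class L) -> stable_lattice v rho L.
  move=> [L' L'st eqL]; have := homothety_class_refl L.
  by rewrite -eqL => -[a a0 ->]; apply: stable_lattice_homothety.
by move=> /stab st1 /stab st2; exists (L1 `&` L2); first exact: stable_latticeI.
Qed.

Lemma tropically_convex_bigcap (T : set (set (set V))) n (M : 'I_n.+1 -> set V) :
  tropically_convex v T ->
  (forall i, stable_lattice v rho (M i)) -> (forall i, T (homothety_class (M i))) ->
  T (homothety_class (\bigcap_(i in [set: 'I_n.+1]) M i)).
Proof.
move=> [_ Tconv] Mst TM.
(* Partial intersections reduce the claim to binary ones. Stability is carried along because
   convexity applies only to lattices. *)
pose D k := \bigcap_(i in [set i : 'I_n.+1 | (i <= k)%N]) M i.
suff DP k : stable_lattice v rho (D k) /\ T (homothety_class (D k)).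
  have -> : [set: 'I_n.+1] = [set i : 'I_n.+1 | (i <= n)%N].
    by rewrite eqEsubset; split=> // i _ /=; rewrite -ltnS.
  by case: (DP n).
elim: k => [|k [Dst TD]].
  have -> : D 0%N = M ord0.
    rewrite eqEsubset; split=> [y|y My i]; first by apply.
    by rewrite /= leqn0 => /eqP i0; rewrite (_ : i = ord0) //; apply: val_inj.
  by split.
(* The induction runs over all of [nat]; from [k = n] on, [D k] no longer changes. *)
have [kn|nk] := ltnP k.+1 n.+1; last first.
  rewrite (_ : D k.+1 = D k) //; congr bigcap.
  rewrite eqEsubset; split=> i /= ik; last exact: leqW.
  by rewrite -ltnS; apply: leq_trans nk.
have -> : D k.+1 = D k `&` M (Ordinal kn).
  rewrite eqEsubset; split=> [y Dy|y [Dy My] i].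
    by split=> [i ik|]; apply: Dy => //=; apply: leqW.
  rewrite /= leq_eqVlt => /orP[/eqP ik|]; last exact: Dy.
  by rewrite (_ : i = Ordinal kn) //; apply: val_inj.
split; first exact: stable_latticeI.
by apply: Tconv => //; [case: Dst|case: (Mst (Ordinal kn))].
Qed.

End StableLattices.

Theorem theorem4p13 (K : fieldType) (v : discrete_valuation K) (pi : K)
    (V : vectType K) (G : groupType) (rho : G -> 'End(V))
    (Kcomplete : dval_complete v)
    (pi_unif : uniformiser v pi)
    (rho_rep : is_representation rho)
    (rho_irr : irreducible_representation rho)
    (has_stable : exists L : set V, stable_lattice v rho L) :
  tropical_hull v (maximal_classes v pi rho) = stable_classes v rho /\
  (forall L : set V, stable_lattice v rho L ->
     exists (n : nat) (M : 'I_n.+1 -> set V),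
       (forall i, maximal_stable_lattice v pi rho (M i)) /\
       L = \bigcap_(i in [set: 'I_n.+1]) M i).
Proof.
have bigcapP := stable_lattice_bigcap Kcomplete pi_unif rho_rep rho_irr.
split=> //; rewrite eqEsubset; split=> [C hullC|_ [L Lst <-] T [Tconv maxT]].
  (* The stable classes are themselves a tropically convex set containing the maximal classes, so
     they bound the hull from above. *)
  apply: hullC; split.
    exact: (stable_classes_convex Kcomplete pi_unif rho_rep rho_irr).
  by move=> _ [L [x _ [Lst _ _]] <-]; exists L.
have [n [M [Mmax ->]]] := bigcapP L Lst.
apply: (tropically_convex_bigcap Kcomplete pi_unif rho_rep rho_irr Tconv) => i.
  by have [x _ []] := Mmax i.
by apply: maxT; exists (M i).
Qed.
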